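(* Let $X$ and $Y$ be nominal random variables on the same probability space with values in $\Omega'=\{\omega'_1,\dots,\omega'_a\}$ and $\Omega''=\{\omega''_1,\dots,\omega''_b\}$ respectively, $a,b\ge3$ (case 2: both variables are nominal). Then $\gamma^*(X,Y)=\max_{s_a\in S_a,\,s_b\in S_b}\gamma(X^{s_a},Y^{s_b})$ is a proper dependence measure, i.e.: (A) Existence: $\gamma^*(X,Y)$ exists for every such pair $(X,Y)$. (B) Normalization: $0\le\gamma^*(X,Y)\le1$. (C) Independence: $\gamma^*(X,Y)=0$ if and only if $X$ and $Y$ are independent. (D) Attainability: $\gamma^*(X,Y)=1$ if and only if $X$ and $Y$ are perfectly dependent. (F) Symmetry: $\gamma^*(X,Y)=\gamma^*(Y,X)$.
   Context: A nominal random variable takes values in a finite set with at least $3$ elements (listed in an arbitrary but fixed way, no natural order), each having positive probability. $S_m$ is the set of permutations of $\{1,\dots,m\}$. For $s_a\in S_a$, $X^{s_a}$ is the real-valued random variable equal to $s_a(i)$ when $X=\omega'_i$; for $s_b\in S_b$, $Y^{s_b}$ equals $s_b(j)$ when $Y=\omega''_j$. Goodman–Kruskal's gamma of real-valued random variables $V,W$ is $$\gamma(V,W)=\frac{\mathbb{P}((V-\tilde V)(W-\tilde W)>0)-\mathbb{P}((V-\tilde V)(W-\tilde W)<0)}{\mathbb{P}((V-\tilde V)(W-\tilde W)>0)+\mathbb{P}((V-\tilde V)(W-\tilde W)<0)},$$ where $(\tilde V,\tilde W)$ is an independent copy of $(V,W)$. $X$ and $Y$ are perfectly dependent if there exist $s_a\in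 S_a$, $s_b\in S_b$ such that the joint CDF $F_{X^{s_a},Y^{s_b}}$ equals either the Fréchet–Hoeffding upper bound $\min\{F_{X^{s_a}}(x),F_{Y^{s_b}}(y)\}$ or the Fréchet–Hoeffding lower bound $\max\{0,F_{X^{s_a}}(x)+F_{Y^{s_b}}(y)-1\}$. A proper dependence measure satisfies axioms (A)–(F); axiom (E) (invariance under strictly monotonic transformations of $Y$) only applies if $Y$ has at least an ordinal scale and is therefore not applicable here. *)

(* Defs.v *)
From HB Require Import structures.
From mathcomp Require Import all_boot all_order all_algebra all_fingroup.
From mathcomp Require Import all_classical all_reals all_analysis.

Set Implicit Arguments.
Unset Strict Implicit.
Unset Printing Implicit Defensive.

Import Order.TTheory GRing.Theory Num.Theory.

Local Open Scope classical_set_scope.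
Local Open Scope ring_scope.

(* A nominal random variable with set of values [O]. The arbitrary but fixed
   listing of the values is the enumeration carried by the [finType] [O]: the
   (i+1)-st value is [enum_val i], for [i : 'I_#|O|]. *)
Record nominalRV (d : measure_display) (T : measurableType d) (R : realType)
    (P : probability T R) (O : finType) := NominalRV {
  nominal_fun :> T -> O ;
  nominal_measurable : forall A : set O, measurable (nominal_fun @^-1` A) ;
  nominal_gt0 : forall o : O, (0 < P (nominal_fun @^-1` [set o]))%E
}.

Section Nominal.
Context (d : measure_display) (T : measurableType d) (R : realType).
Variable P : probability T R.

(* X^s. Elements of ['I_n] count from 0, hence the successor. *)
Definition coded_fun (O : finType) (X : nominalRV P O) (s : 'S_#|O|) : T -> R :=
  fun t => (s (enum_rank (X t))).+1%:R.

Lemma measurable_coded_fun (O : finType) (X : nominalRV P O) (s : 'S_#|O|) :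
  measurable_fun setT (coded_fun X s).
Proof.
move=> _ B _; rewrite setTI.
exact: (nominal_measurable X [set o | B (s (enum_rank o)).+1%:R]).
Qed.

HB.instance Definition _ (O : finType) (X : nominalRV P O) (s : 'S_#|O|) :=
  isMeasurableFun.Build _ _ _ _ (coded_fun X s) (measurable_coded_fun X s).

Definition coded (O : finType) (X : nominalRV P O) (s : 'S_#|O|) :
  {RV P >-> R} := coded_fun X s.

(* On the product space with measure [P \x P], [(V u.1, W u.1)] is distributed
   as [(V, W)] and [(V u.2, W u.2)] is an independent copy of it. *)
Definition prob_concordant (V W : {RV P >-> R}) : R :=
  fine ((P \x P)%E
    [set u : T * T | 0 < (V u.1 - V u.2) * (W u.1 - W u.2)]).

Definition prob_discordant (V W : {RV P >-> R}) : R :=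
  fine ((P \x P)%E
    [set u : T * T | (V u.1 - V u.2) * (W u.1 - W u.2) < 0]).

(* Division in [R] is total, so that the quotient [gamma] only has a meaning
   under [gamma_exists]. *)
Definition gamma_exists (V W : {RV P >-> R}) : Prop :=
  prob_concordant V W + prob_discordant V W != 0.

Definition gamma (V W : {RV P >-> R}) : R :=
  (prob_concordant V W - prob_discordant V W) /
  (prob_concordant V W + prob_discordant V W).

(* The index of the big operator ranges over all pairs of permutations; its
   initial value is the term of the pair of identities, so that this is the
   maximum of the [gamma]'s themselves. *)
Definition gamma_star (O1 O2 : finType)
    (X : nominalRV P O1) (Y : nominalRV P O2) : R :=
  \big[Num.max/gamma (coded X 1%g) (coded Y 1%g)]_(s : 'S_#|O1| * 'S_#|O2|)
    gamma (coded X s.1) (coded Y s.2).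

Definition joint_cdf (V W : {RV P >-> R}) (x y : R) : \bar R :=
  P [set t | V t <= x /\ W t <= y].

Definition perfectly_dependent (O1 O2 : finType)
    (X : nominalRV P O1) (Y : nominalRV P O2) : Prop :=
  exists (sa : 'S_#|O1|) (sb : 'S_#|O2|),
    (forall x y : R, joint_cdf (coded X sa) (coded Y sb) x y =
       mine (cdf (coded X sa) x) (cdf (coded Y sb) y)) \/
    (forall x y : R, joint_cdf (coded X sa) (coded Y sb) x y =
       maxe 0%E (cdf (coded X sa) x + cdf (coded Y sb) y - 1)%E).

Definition independent (O1 O2 : finType)
    (X : nominalRV P O1) (Y : nominalRV P O2) : Prop :=
  forall (A : set O1) (B : set O2),
    P ((X @^-1` A) `&` (Y @^-1` B)) = (P (X @^-1` A) * P (Y @^-1` B))%E.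

End Nominal.

(* Main.v *)
(* Let m z be the mass of the cell z of O1 * O2, and C and D the concordance and
   discordance probabilities. Reversing the order of the values of X exchanges
   C and D, hence negates gamma. So gamma_star >= 0, and gamma_star = 0 forces
   C = D for all pairs of orders; comparing two orders that differ by an
   adjacent transposition, first for Y and then for X, shows that all 2 x 2
   minors of m vanish, that is, X and Y are independent. Finally gamma = 1 means
   D = 0, which says that at every (x, y) one of the quadrants (V <= x, W > y)
   and (V > x, W <= y) is null, where V and W are the coded variables; this is
   equality with the upper Frechet-Hoeffding bound. The lower bound gives C = 0,
   which a reversal turns into D = 0. *)
Require Import Defs.
From mathcomp Require Import all_boot all_order all_algebra all_fingroup.
From mathcomp Require Import all_classical all_reals all_analysis.
From mathcomp Require Import ring lra.

Import Order.TTheory GRing.Theory Num.Theory.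

Local Open Scope ring_scope.

(** * Finite joint law of the two variables *)

Lemma measure_preimage_fin (d : measure_display) (T : measurableType d)
    (R : realType) (mu : {measure set T -> \bar R}) (O : finType) (Z : T -> O)
    (q : pred O) :
  (forall o, measurable (Z @^-1` [set o])%classic) ->
  mu [set t | q (Z t)]%classic
    = (\sum_(o | q o) mu (Z @^-1` [set o])%classic)%E.
Proof.
move=> mZ.
have -> : [set t | q (Z t)]%classic
    = (\bigcup_(o in [set` enum q]) Z @^-1` [set o])%classic.
  apply/seteqP; split=> [t /= qt|t [z /=] ].
    by exists (Z t) => //=; rewrite mem_enum.
  by rewrite mem_enum => qz ->.
rewrite measure_fin_bigcup //; last first.
  exact: trivIset_preimage1.
by rewrite -fsbig_seq ?enum_uniq// big_enum.
Qed.

Section JointMass.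
Context {d : measure_display} {T : measurableType d} {R : realType}.
Context {P : probability T R} {O1 O2 : finType}.
Variables (X : nominalRV P O1) (Y : nominalRV P O2).

Definition joint_mass (z : O1 * O2) : R :=
  fine (P ((X @^-1` [set z.1]) `&` (Y @^-1` [set z.2]))%classic).

Let Z t := (X t, Y t).

Let preimage_pair z :
  (Z @^-1` [set z] = (X @^-1` [set z.1]) `&` (Y @^-1` [set z.2]))%classic.
Proof.
by case: z => i j; rewrite /Z; apply/seteqP;
  split=> t /=; [case=> <- <- | case=> -> ->].
Qed.

Let measurable_pair z : measurable (Z @^-1` [set z])%classic.
Proof.
by rewrite preimage_pair; apply: measurableI; exact: nominal_measurable.
Qed.

Let joint_massE z : P (Z @^-1` [set z])%classic = (joint_mass z)%:E.
Proof. by rewrite preimage_pair fineK// fin_num_measure// -preimage_pair. Qed.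

Lemma joint_mass_ge0 z : 0 <= joint_mass z.
Proof. exact: fine_ge0. Qed.

Lemma prob_joint (q : pred (O1 * O2)) :
  P [set t | q (X t, Y t)]%classic = (\sum_(z | q z) joint_mass z)%:E.
Proof.
rewrite (@measure_preimage_fin _ _ _ P _ Z) // -sumEFin.
by apply: eq_bigr => z _; exact: joint_massE.
Qed.

(** The preimage of a pair of cells is a rectangle, whose product measure is a product of masses;
    the independent copy thus becomes a double sum. *)
Lemma prob_joint_pair (r : rel (O1 * O2)) :
  fine ((P \x P)%E
    [set u : T * T | r (X u.1, Y u.1) (X u.2, Y u.2)]%classic)
  = \sum_(w | r w.1 w.2) joint_mass w.1 * joint_mass w.2.
Proof.
pose W (u : T * T) := (Z u.1, Z u.2).
have WE w :
    (W @^-1` [set w] = (Z @^-1` [set w.1]) `*` (Z @^-1` [set w.2]))%classic.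
  by case: w => z z'; rewrite /W; apply/seteqP;
    split=> u /=; [case=> <- <- | case=> -> ->].
rewrite (@measure_preimage_fin _ _ _ (P \x P)%E _ W (fun w => r w.1 w.2)).
  rewrite (eq_bigr (fun w => (joint_mass w.1 * joint_mass w.2)%:E)) ?sumEFin//.
  move=> w _; rewrite WE EFinM -!joint_massE.
  exact: (product_measure1E P P).
by move=> w; rewrite WE; apply: measurableX.
Qed.

Lemma sum_joint_mass : \sum_z joint_mass z = 1.
Proof.
apply: EFin_inj; rewrite -(prob_joint xpredT).
by rewrite -[RHS](@probability_setT _ _ _ P); congr (P _); apply/seteqP.
Qed.

Lemma joint_mass_row i : exists j, 0 < joint_mass (i, j).
Proof.
have := nominal_gt0 X i.
have -> : (X @^-1` [set i] = [set t | (X t, Y t).1 == i])%classic.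
  by apply/seteqP; split=> t /eqP.
rewrite (prob_joint (fun z => z.1 == i)) lte_fin.
move=> /lt0r_neq0/eqP/(psumr_neq0P (fun z _ => joint_mass_ge0 z)).
by case=> -[k j] /= /andP[/eqP -> pj]; exists j.
Qed.

Lemma joint_mass_col j : exists i, 0 < joint_mass (i, j).
Proof.
have := nominal_gt0 Y j.
have -> : (Y @^-1` [set j] = [set t | (X t, Y t).2 == j])%classic.
  by apply/seteqP; split=> t /eqP.
rewrite (prob_joint (fun z => z.2 == j)) lte_fin.
move=> /lt0r_neq0/eqP/(psumr_neq0P (fun z _ => joint_mass_ge0 z)).
by case=> -[i k] /= /andP[/eqP -> pi]; exists i.
Qed.

(** Take positive cells in two rows. If they share a column, a positive cell of another column lies
    in a different row from at least one of them. *)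
Lemma joint_mass_split : (1 < #|O1|)%N -> (1 < #|O2|)%N ->
  exists z w, [/\ z.1 != w.1, z.2 != w.2, 0 < joint_mass z & 0 < joint_mass w].
Proof.
move=> /card_gt1P[i [i' [_ _ ii'] ] ] /card_gt1P[k [k' [_ _ kk'] ] ].
have [j pj] := joint_mass_row i; have [j' pj'] := joint_mass_row i'.
have [jj'|jj'] := eqVneq j j'; last by exists (i, j), (i', j').
rewrite -{j'}jj' in pj'.
have [l lj] : exists l, l != j.
  by have [kj|] := eqVneq k j; [exists k'; rewrite -kj eq_sym | exists k].
have [m pm] := joint_mass_col l.
have [mi|mi] := eqVneq m i; last by exists (m, l), (i, j).
by exists (m, l), (i', j); split=> //; rewrite mi.
Qed.

End JointMass.

(** Turns one diagonal of a 2 x 2 minor into the other. *)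
Definition swap_second {A B : Type} (w : (A * B) * (A * B)) :=
  ((w.1.1, w.2.2), (w.2.1, w.1.2)).

Lemma swap_secondK {A B : Type} :
  involutive (@swap_second A B).
Proof. by case=> -[a b] [a' b']. Qed.

Lemma sgr_natB {R : realDomainType} (m n : nat) :
  Num.sg (m%:R - n%:R : R) = (n < m)%N%:R - (m < n)%N%:R.
Proof.
case: (ltngtP n m) => [lt_nm|lt_mn|->].
- by rewrite gtr0_sg ?subr0// subr_gt0 ltr_nat.
- by rewrite ltr0_sg ?sub0r// subr_lt0 ltr_nat.
- by rewrite !subrr sgr0.
Qed.

(** * Codings by permutations *)

Section Code.
Context {R : realType} {O : finType}.

(** By conversion, [coded X s t] is [code s (X t)]. *)
Definition code (s : 'S_#|O|) (o : O) : R := (s (enum_rank o)).+1%:R.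

Lemma code_inj s : injective (code s).
Proof.
move=> o o' /eqP; rewrite eqr_nat eqSS => /eqP/val_inj/perm_inj.
exact: enum_rank_inj.
Qed.

Definition rev_perm n : 'S_n := perm (@rev_ord_inj n).

Lemma code_rev s o : code (s * rev_perm #|O|)%g o = #|O|.+1%:R - code s o.
Proof.
rewrite /code permM permE /= subnSK// -natrB ?subSS//.
by rewrite ltnS ltnW.
Qed.

Lemma sgr_codeB s o o' : Num.sg (code s o - code s o')
  = (s (enum_rank o') < s (enum_rank o))%N%:R
    - (s (enum_rank o) < s (enum_rank o'))%N%:R.
Proof. exact: sgr_natB. Qed.

(* Two orders differing by the exchange of the first two elements [a] and [b]
   give sums that differ by [2 * (K b a - K a b)]. *)
Lemma sum_sgr_code_eq0 (K : O -> O -> R) :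
  (forall s, \sum_a \sum_b K a b * Num.sg (code s a - code s b) = 0) ->
  forall a b, K a b = K b a.
Proof.
move=> K0 a b; have [->//|ab] := eqVneq a b.
have O_gt1 : (1 < #|O|)%N by apply/card_gt1P; exists a, b.
pose i0 := Ordinal (ltnW O_gt1); pose i1 := Ordinal O_gt1.
(* [t] moves [a] to the first position; the next transposition moves [b] to the second one and fixes
   [i0], so [s] lists [a] first and [b] second. *)
pose t := tperm (enum_rank a) i0.
pose s := (t * tperm (t (enum_rank b)) i1)%g.
have tb : t (enum_rank b) != i0.
  rewrite -[X in _ != X](tpermL (enum_rank a) i0) (inj_eq perm_inj).
  by rewrite (inj_eq enum_rank_inj) eq_sym.
have sa : s (enum_rank a) = i0 by rewrite permM tpermL tpermD// eq_sym.
have sb : s (enum_rank b) = i1 by rewrite permM tpermL.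
pose s' := (s * tperm i0 i1)%g.
have s'a : s' (enum_rank a) = i1 by rewrite permM sa tpermL.
have s'b : s' (enum_rank b) = i0 by rewrite permM sb tpermR.
have s_ge2 c : c != a -> c != b -> (1 < s (enum_rank c))%N.
  move=> ca cb; have h0 : s (enum_rank c) != i0.
    by rewrite -sa (inj_eq perm_inj) (inj_eq enum_rank_inj).
  have h1 : s (enum_rank c) != i1.
    by rewrite -sb (inj_eq perm_inj) (inj_eq enum_rank_inj).
  by move: h0 h1; rewrite -!val_eqE /=; case: (val _) => [|[|]].
have s'c c : c != a -> c != b -> s' (enum_rank c) = s (enum_rank c).
  move=> ca cb; rewrite permM tpermD// eq_sym.
    by rewrite -sa (inj_eq perm_inj) (inj_eq enum_rank_inj).
  by rewrite -sb (inj_eq perm_inj) (inj_eq enum_rank_inj).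
(* Every other element has the same rank, at least 2, in both orders, so only the comparison of [a]
   with [b] changes. *)
have diff c e : Num.sg (code s' c - code s' e) - Num.sg (code s c - code s e)
    = 2 * (((c, e) == (a, b))%:R - ((c, e) == (b, a))%:R) :> R.
  rewrite !sgr_codeB !xpair_eqE.
  have cases f : [\/ f = a, f = b | f != a /\ f != b].
    have [->|fa] := eqVneq f a; first by constructor 1.
    by have [->|fb] := eqVneq f b; [constructor 2|constructor 3].
  have ba : (b == a) = false by rewrite eq_sym (negbTE ab).
  have other f : f != a -> f != b -> s' (enum_rank f) = s (enum_rank f)
      /\ exists k, nat_of_ord (s (enum_rank f)) = k.+2.
    move=> fa fb; split; first exact: s'c.
    by have := s_ge2 _ fa fb; case: (nat_of_ord _) => [|[|k]]// _; exists k.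
  case: (cases c) => [->|->|[ca cb]]; case: (cases e) => [->|->|[ea eb]];
    rewrite ?eqxx ?ba ?(negbTE ab) ?sa ?sb ?s'a ?s'b /=;
    try (rewrite ?(negbTE ca) ?(negbTE cb); have [-> [k ->]] := other _ ca cb);
    try (rewrite ?(negbTE ea) ?(negbTE eb); have [-> [l ->]] := other _ ea eb);
    rewrite ?andbF /=; ring.
have pick c0 e0 : \sum_c \sum_e K c e * ((c, e) == (c0, e0))%:R = K c0 e0.
  rewrite pair_bigA (bigD1 (c0, e0)) //= eqxx mulr1 big1 ?addr0//.
  by case=> c e /negbTE /= ->; rewrite mulr0.
have : \sum_c \sum_e K c e *
    (Num.sg (code s' c - code s' e) - Num.sg (code s c - code s e)) = 0.
  under eq_bigr do under eq_bigr do rewrite mulrBr.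
  by under eq_bigr do rewrite sumrB; rewrite sumrB !K0 subrr.
under eq_bigr do under eq_bigr do rewrite diff mulrCA mulrBr.
under eq_bigr do rewrite -mulr_sumr sumrB.
rewrite -mulr_sumr sumrB !pick => /eqP.
by rewrite mulf_eq0 pnatr_eq0 /= subr_eq0 => /eqP.
Qed.

End Code.

(** * Null sets of cells and sums over pairs *)

Section Quadrants.
Context {R : realType} {I : finType}.
Variable m : I -> R.
Hypothesis m_ge0 : forall z, 0 <= m z.

Lemma sum_pair_eq0 (r : rel I) :
  (forall z w, r z w -> exists q1 q2 : pred I,
     [/\ q1 z, q2 w & \sum_(t | q1 t) m t = 0 \/ \sum_(t | q2 t) m t = 0]) ->
  \sum_(w | r w.1 w.2) m w.1 * m w.2 = 0.
Proof.
move=> h; apply: big1 => -[z w] /= /h[q1 [q2 [q1z q2w]]].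
by case=> /psumr_eq0P q0; [rewrite (q0 _ z) ?mul0r|rewrite (q0 _ w) ?mulr0].
Qed.

(** If some cell of [q1] has positive mass, pairing it with any cell of [q2] gives a zero term,
    which makes the latter cell null. *)
Lemma sum_pair_neq0 (r : rel I) (q1 q2 : pred I) :
  (forall z w, q1 z -> q2 w -> r z w) ->
  \sum_(w | r w.1 w.2) m w.1 * m w.2 = 0 ->
  \sum_(t | q1 t) m t = 0 \/ \sum_(t | q2 t) m t = 0.
Proof.
move=> h r0.
have [->|/eqP/(psumr_neq0P (fun z _ => m_ge0 z))] :=
  eqVneq (\sum_(t | q1 t) m t) 0; first by left.
case=> z /andP[q1z mz]; right; apply: big1 => w q2w.
have /eqP := psumr_eq0P (fun w _ => mulr_ge0 (m_ge0 w.1) (m_ge0 w.2)) r0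
  (h z w q1z q2w : r (z, w).1 (z, w).2).
by rewrite mulf_eq0 gt_eqF// => /eqP.
Qed.

End Quadrants.

(** * Reversal, nonzero denominators and range of [gamma] *)

Section Gamma.
Context {d : measure_display} {T : measurableType d} {R : realType}.
Context {P : probability T R} {O1 O2 : finType}.
Variables (X : nominalRV P O1) (Y : nominalRV P O2).
Local Notation m := (joint_mass X Y).
Implicit Types (sa : 'S_#|O1|) (sb : 'S_#|O2|) (z : O1 * O2).

Definition rank_product sa sb (z w : O1 * O2) : R :=
  (code sa z.1 - code sa w.1) * (code sb z.2 - code sb w.2).

Lemma concordantE sa sb :
  prob_concordant (coded X sa) (coded Y sb)
  = \sum_(w | 0 < rank_product sa sb w.1 w.2) m w.1 * m w.2.
Proof.
exact: (prob_joint_pair X Y (fun z w => 0 < rank_product sa sb z w)).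
Qed.

Lemma discordantE sa sb :
  prob_discordant (coded X sa) (coded Y sb)
  = \sum_(w | rank_product sa sb w.1 w.2 < 0) m w.1 * m w.2.
Proof.
exact: (prob_joint_pair X Y (fun z w => rank_product sa sb z w < 0)).
Qed.

Lemma concordant_ge0 sa sb : 0 <= prob_concordant (coded X sa) (coded Y sb).
Proof. exact: fine_ge0. Qed.

Lemma discordant_ge0 sa sb : 0 <= prob_discordant (coded X sa) (coded Y sb).
Proof. exact: fine_ge0. Qed.

Lemma rank_product_rev sa sb z w :
  rank_product (sa * rev_perm #|O1|) sb z w = - rank_product sa sb z w.
Proof. by rewrite /rank_product !code_rev; ring. Qed.

Lemma concordant_rev sa sb :
  prob_concordant (coded X (sa * rev_perm #|O1|)%g) (coded Y sb)
  = prob_discordant (coded X sa) (coded Y sb).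
Proof.
rewrite concordantE discordantE; apply: eq_bigl => w.
by rewrite rank_product_rev oppr_gt0.
Qed.

Lemma discordant_rev sa sb :
  prob_discordant (coded X (sa * rev_perm #|O1|)%g) (coded Y sb)
  = prob_concordant (coded X sa) (coded Y sb).
Proof.
rewrite concordantE discordantE; apply: eq_bigl => w.
by rewrite rank_product_rev oppr_lt0.
Qed.

Lemma gamma_rev sa sb :
  gamma (coded X (sa * rev_perm #|O1|)%g) (coded Y sb)
  = - gamma (coded X sa) (coded Y sb).
Proof.
rewrite /gamma concordant_rev discordant_rev.
by rewrite -opprB mulNr [X in _ / X]addrC.
Qed.

(** Two positive cells that differ in both coordinates have a nonzero rank product, as [code] is
    injective; this pair counts in one of the two sums. *)
Lemma concordantD_gt0 sa sb : (1 < #|O1|)%N -> (1 < #|O2|)%N ->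
  0 < prob_concordant (coded X sa) (coded Y sb)
      + prob_discordant (coded X sa) (coded Y sb).
Proof.
move=> O1_gt1 O2_gt1.
have [z [w [zw1 zw2 mz mw]]] := joint_mass_split X Y O1_gt1 O2_gt1.
have mm_ge0 u : 0 <= m u.1 * m u.2 by rewrite mulr_ge0 ?joint_mass_ge0.
have rp0 : rank_product sa sb z w != 0.
  by rewrite mulf_neq0// subr_eq0 (inj_eq (code_inj _)).
rewrite concordantE discordantE.
set C := \sum_(u | _) _; set D := \sum_(u | _) _.
have C_ge0 : 0 <= C by exact: sumr_ge0.
have D_ge0 : 0 <= D by exact: sumr_ge0.
rewrite lt0r addr_ge0// andbT paddr_eq0//.
apply/negP => /andP[/eqP c0 /eqP d0].
have mzw : m z * m w = 0.
  have [rp|rp|/eqP] := ltgtP (rank_product sa sb z w) 0.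
  - exact: (psumr_eq0P (fun u _ => mm_ge0 u) d0
      (rp : rank_product sa sb (z, w).1 (z, w).2 < 0)).
  - exact: (psumr_eq0P (fun u _ => mm_ge0 u) c0
      (rp : 0 < rank_product sa sb (z, w).1 (z, w).2)).
  - by rewrite (negbTE rp0).
by have := mulr_gt0 mz mw; rewrite mzw ltxx.
Qed.

Lemma gamma_le1 sa sb : gamma (coded X sa) (coded Y sb) <= 1.
Proof.
rewrite /gamma; have := concordant_ge0 sa sb; have := discordant_ge0 sa sb.
set C := prob_concordant _ _; set D := prob_discordant _ _ => D0 C0.
(* The inverse of 0 is 0, so a zero denominator gives the value 0. *)
have [->|CD0] := eqVneq (C + D) 0; first by rewrite invr0 mulr0.
by rewrite ler_pdivrMr ?lt0r ?CD0 ?addr_ge0//; lra.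
Qed.

Lemma gamma_eq1 sa sb : (1 < #|O1|)%N -> (1 < #|O2|)%N ->
  gamma (coded X sa) (coded Y sb) = 1 <->
  prob_discordant (coded X sa) (coded Y sb) = 0.
Proof.
move=> O1_gt1 O2_gt1; have := concordantD_gt0 sa sb O1_gt1 O2_gt1.
rewrite /gamma.
set C := prob_concordant _ _; set D := prob_discordant _ _ => CD.
split=> [|D0].
  move=> /(congr1 (fun x => x * (C + D))); rewrite divfK ?gt_eqF// mul1r; lra.
by rewrite D0 addr0 in CD *; rewrite subr0 divff// gt_eqF.
Qed.

(** * Equality of concordance and discordance versus independence *)

Lemma concordantB sa sb :
  prob_concordant (coded X sa) (coded Y sb)
    - prob_discordant (coded X sa) (coded Y sb)
  = \sum_z \sum_w m z * m w *
      (Num.sg (code sa z.1 - code sa w.1) * Num.sg (code sb z.2 - code sb w.2)).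
Proof.
rewrite concordantE discordantE.
rewrite [X in X - _]big_mkcond [X in _ - X]big_mkcond /=.
rewrite -sumrB pair_bigA; apply: eq_bigr => -[z w] _ /=.
(* The sign of the rank product splits into a row sign and a column sign, so that one order can vary
   while the other is fixed. *)
rewrite -sgrM -/(rank_product sa sb z w).
by case: sgrP => _; ring.
Qed.

Lemma independentP :
  independent X Y <->
  forall w : (O1 * O2) * (O1 * O2),
    m w.1 * m w.2 = m (swap_second w).1 * m (swap_second w).2.
Proof.
split=> [ind [z w]|cross A B].
  have mE u : m u = fine (P (X @^-1` [set u.1])%classic)
      * fine (P (Y @^-1` [set u.2])%classic).
    by rewrite /joint_mass ind fineM//
      fin_num_measure//; exact: nominal_measurable.
  by rewrite !mE /=; ring.
have -> : (X @^-1` A = [set t | (X t, Y t).1 \in A])%classic.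
  by apply/seteqP; split=> t /=; rewrite in_setE.
have -> : (Y @^-1` B = [set t | (X t, Y t).2 \in B])%classic.
  by apply/seteqP; split=> t /=; rewrite in_setE.
have -> : ([set t | (X t, Y t).1 \in A] `&` [set t | (X t, Y t).2 \in B]
    = [set t | ((X t, Y t).1 \in A) && ((X t, Y t).2 \in B)])%classic.
  by apply/seteqP; split=> t /= => [[-> ->]|/andP[]].
rewrite (prob_joint X Y (fun z => (z.1 \in A) && (z.2 \in B))).
rewrite (prob_joint X Y (fun z => z.1 \in A)).
rewrite (prob_joint X Y (fun z => z.2 \in B)) -EFinM; congr EFin.
(* The factor 1 becomes the total mass, which makes both sides sums over pairs of cells;
   [swap_second] then matches their conditions. *)
rewrite -[LHS]mulr1 -{1}(sum_joint_mass X Y) !big_distrlr /= !pair_big_dep /=.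
rewrite (reindex_inj (inv_inj swap_secondK)) /=.
by apply: eq_big => [w|w _]; rewrite ?andbT// -cross.
Qed.

(** Under independence [swap_second] preserves the product of masses, and it negates the rank
    product. *)
Lemma independent_concordant sa sb : independent X Y ->
  prob_concordant (coded X sa) (coded Y sb)
  = prob_discordant (coded X sa) (coded Y sb).
Proof.
move=> /independentP cross; rewrite concordantE discordantE.
rewrite (reindex_inj (inv_inj swap_secondK)) /=.
apply: eq_big => [w|w _]; last by rewrite -cross.
by rewrite -oppr_lt0 /rank_product /= -mulrN opprB.
Qed.

(** [sum_sgr_code_eq0] is used twice: with [sa] fixed while the order on [O2] varies, then with two
    columns fixed while the order on [O1] varies. *)
Lemma concordant_independent :
  (forall sa sb, prob_concordant (coded X sa) (coded Y sb)
     = prob_discordant (coded X sa) (coded Y sb)) ->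
  independent X Y.
Proof.
move=> CD; apply/independentP.
(* The part of the sum in [concordantB] carried by two given columns, without its column sign. *)
pose A sa j j' := \sum_i \sum_i' m (i, j) * m (i', j') *
  Num.sg (code sa i - code sa i' : R).
have Asym sa j j' : A sa j j' = A sa j' j.
  apply: (@sum_sgr_code_eq0 R) => sb.
  transitivity (prob_concordant (coded X sa) (coded Y sb)
    - prob_discordant (coded X sa) (coded Y sb)); last by rewrite CD subrr.
  rewrite concordantB.
  (* Column indices are moved outwards until the inner sums over rows form [A]. *)
  rewrite -(pair_bigA _ (fun i j => \sum_w m (i, j) * m w *
    (Num.sg (code sa i - code sa w.1) * Num.sg (code sb j - code sb w.2)))) /=.
  rewrite [RHS]exchange_big; apply: eq_bigr => k _.
  under [RHS]eq_bigr => i _.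
    rewrite -(pair_bigA _ (fun i' j' => m (i, k) * m (i', j') *
      (Num.sg (code sa i - code sa i') * Num.sg (code sb k - code sb j')))) /=.
    rewrite exchange_big; over.
  rewrite [RHS]exchange_big; apply: eq_bigr => l _.
  rewrite /A mulr_suml; apply: eq_bigr => i _; rewrite mulr_suml.
  by apply: eq_bigr => i' _; rewrite mulrA.
move=> [[i j] [i' j']] /=.
(* A 2 x 2 minor, antisymmetric in its rows; symmetry then forces it to vanish. *)
pose K i i' := m (i, j) * m (i', j') - m (i, j') * m (i', j).
have : K i i' = K i' i.
  apply: (@sum_sgr_code_eq0 R) => sa.
  transitivity (A sa j j' - A sa j' j); last by rewrite Asym subrr.
  rewrite -sumrB; apply: eq_bigr => k _; rewrite -sumrB.
  by apply: eq_bigr => l _; rewrite mulrBl.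
by rewrite /K; lra.
Qed.

(** * Frechet-Hoeffding bounds and null quadrants *)

Lemma joint_cdf_codedE sa sb (x y : R) :
  joint_cdf (coded X sa) (coded Y sb) x y
  = (\sum_(z | (code sa z.1 <= x) && (code sb z.2 <= y)) m z)%:E.
Proof.
rewrite -(prob_joint X Y (fun z => (code sa z.1 <= x) && (code sb z.2 <= y))).
by congr (P _); apply/seteqP; split=> t /= => [[-> ->]|/andP[]].
Qed.

Lemma cdf_coded_fstE sa (x : R) :
  cdf (coded X sa) x = (\sum_(z | code sa z.1 <= x) m z)%:E.
Proof.
rewrite -(prob_joint X Y (fun z => code sa z.1 <= x)).
by congr (P _); apply/seteqP; split=> t /=; rewrite in_itv.
Qed.

Lemma cdf_coded_sndE sb (y : R) :
  cdf (coded Y sb) y = (\sum_(z | code sb z.2 <= y) m z)%:E.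
Proof.
rewrite -(prob_joint X Y (fun z => code sb z.2 <= y)).
by congr (P _); apply/seteqP; split=> t /=; rewrite in_itv.
Qed.

(** Marginals and total of the 2 x 2 table cut at [(x, y)]; they turn both bounds into linear
    arithmetic. *)
Lemma quadrant_split sa sb (x y : R) :
  let a := \sum_(z | (code sa z.1 <= x) && (code sb z.2 <= y)) m z in
  let b := \sum_(z | (code sa z.1 <= x) && (y < code sb z.2)) m z in
  let c := \sum_(z | (x < code sa z.1) && (code sb z.2 <= y)) m z in
  let e := \sum_(z | (x < code sa z.1) && (y < code sb z.2)) m z in
  [/\ \sum_(z | code sa z.1 <= x) m z = a + b,
      \sum_(z | code sb z.2 <= y) m z = a + c
    & a + b + c + e = 1].
Proof.
move=> a b c e.
have rowE : \sum_(z | code sa z.1 <= x) m z = a + b.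
  rewrite (bigID (fun z => code sb z.2 <= y)) /=; congr (_ + _).
  by apply: eq_bigl => z; rewrite -ltNge.
split=> //.
  rewrite (bigID (fun z => code sa z.1 <= x)) /=; congr (_ + _).
    by apply: eq_bigl => z; rewrite andbC.
  by apply: eq_bigl => z; rewrite -ltNge andbC.
rewrite -(sum_joint_mass X Y) (bigID (fun z => code sa z.1 <= x)) /= rowE.
rewrite -addrA; congr (_ + _).
rewrite [RHS](bigID (fun z => code sb z.2 <= y)) /=; congr (_ + _);
  by apply: eq_bigl => z; rewrite -!ltNge.
Qed.

(** In quadrant masses the bound reads [a = min (a + b, a + c)], that is [min (b, c) = 0]. *)
Lemma upper_bound_quadrants sa sb (x y : R) :
  joint_cdf (coded X sa) (coded Y sb) x y =
    mine (cdf (coded X sa) x) (cdf (coded Y sb) y) <->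
  \sum_(z | (code sa z.1 <= x) && (y < code sb z.2)) m z = 0 \/
  \sum_(z | (x < code sa z.1) && (code sb z.2 <= y)) m z = 0.
Proof.
have [] := quadrant_split sa sb x y.
rewrite joint_cdf_codedE cdf_coded_fstE cdf_coded_sndE => -> -> _.
set a := \sum_(z | _) _; set b := \sum_(z | _) _; set c := \sum_(z | _) _.
have b0 : 0 <= b by apply: sumr_ge0 => z _; exact: joint_mass_ge0.
have c0 : 0 <= c by apply: sumr_ge0 => z _; exact: joint_mass_ge0.
rewrite -EFin_min minEle lerD2l; split.
  by case; case: ifP => _ h; [left|right]; lra.
by case=> h; case: ifP => bc; congr EFin; lra.
Qed.

(** As the four quadrant masses add up to 1, the bound reads [a = max (0, a - e)]. *)
Lemma lower_bound_quadrants sa sb (x y : R) :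
  joint_cdf (coded X sa) (coded Y sb) x y =
    maxe 0%E (cdf (coded X sa) x + cdf (coded Y sb) y - 1)%E ->
  \sum_(z | (code sa z.1 <= x) && (code sb z.2 <= y)) m z = 0 \/
  \sum_(z | (x < code sa z.1) && (y < code sb z.2)) m z = 0.
Proof.
have [] := quadrant_split sa sb x y.
rewrite joint_cdf_codedE cdf_coded_fstE cdf_coded_sndE => -> ->.
set a := \sum_(z | _) _; set b := \sum_(z | _) _; set c := \sum_(z | _) _.
set e := \sum_(z | _) _ => abce.
rewrite -EFinN -!EFinD -EFin_max => -[].
by rewrite maxEle; case: ifP => _ h; [right|left]; lra.
Qed.

(** A discordant pair occupies the two off-diagonal quadrants of a suitable cut; conversely, cells
    taken from these two quadrants are discordant. *)
Lemma upper_bound_discordant sa sb :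
  (forall x y, joint_cdf (coded X sa) (coded Y sb) x y =
     mine (cdf (coded X sa) x) (cdf (coded Y sb) y)) <->
  prob_discordant (coded X sa) (coded Y sb) = 0.
Proof.
rewrite discordantE; split=> [bound|D0 x y]; last first.
  apply/upper_bound_quadrants; apply: (sum_pair_neq0 m (joint_mass_ge0 X Y)
    (fun z w => rank_product sa sb z w < 0)) D0.
  move=> z w /andP[zx yz] /andP[xw wy].
  rewrite /rank_product /= nmulr_rlt0 ?subr_gt0 ?subr_lt0.
    exact: le_lt_trans yz.
  exact: le_lt_trans xw.
apply: (sum_pair_eq0 m (joint_mass_ge0 X Y)
  (fun z w => rank_product sa sb z w < 0)) => z w.
rewrite /rank_product /= => rp.
have [v|v] := ltP (code sa z.1 : R) (code sa w.1).
  have u : (code sb w.2 : R) < code sb z.2.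
    by move: rp; rewrite nmulr_rlt0 ?subr_gt0 ?subr_lt0.
  (* The cut is at the smaller code in each coordinate, so that the larger one falls strictly beyond
     it. *)
  have /upper_bound_quadrants h := bound (code sa z.1) (code sb w.2).
  by do 2 eexists; split; last exact: h; rewrite /= ?lexx ?u ?v.
have {}v : (code sa w.1 : R) < code sa z.1.
  rewrite lt_neqAle v andbT; apply: contraTneq rp => ->.
  by rewrite subrr mul0r ltxx.
have u : (code sb z.2 : R) < code sb w.2.
  by move: rp; rewrite pmulr_rlt0 ?subr_gt0 ?subr_lt0.
have /upper_bound_quadrants h := bound (code sa w.1) (code sb z.2).
(* Here [w] is the cell on the left, so the two quadrants trade places. *)
by do 2 eexists; split; last (apply/or_comm; exact: h); rewrite /= ?lexx ?u ?v.
Qed.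

(** Cutting at the lower left cell of a concordant pair puts the two cells in opposite diagonal
    quadrants, one of which is null. *)
Lemma lower_bound_concordant sa sb :
  (forall x y, joint_cdf (coded X sa) (coded Y sb) x y =
     maxe 0%E (cdf (coded X sa) x + cdf (coded Y sb) y - 1)%E) ->
  prob_concordant (coded X sa) (coded Y sb) = 0.
Proof.
move=> bound; rewrite concordantE.
apply: (sum_pair_eq0 m (joint_mass_ge0 X Y)
  (fun z w => 0 < rank_product sa sb z w)) => z w.
rewrite /rank_product /= => rp.
have [v|v] := ltP (code sa z.1 : R) (code sa w.1).
  have u : (code sb z.2 : R) < code sb w.2.
    by move: rp; rewrite nmulr_rgt0 ?subr_gt0 ?subr_lt0.
  have h := lower_bound_quadrants _ _ _ _ (bound (code sa z.1) (code sb z.2)).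
  by do 2 eexists; split; last exact: h; rewrite /= ?lexx ?u ?v.
have {}v : (code sa w.1 : R) < code sa z.1.
  rewrite lt_neqAle v andbT; apply: contraTneq rp => ->.
  by rewrite subrr mul0r ltxx.
have u : (code sb w.2 : R) < code sb z.2.
  by move: rp; rewrite pmulr_rgt0 ?subr_gt0 ?subr_lt0.
have h := lower_bound_quadrants _ _ _ _ (bound (code sa w.1) (code sb w.2)).
by do 2 eexists; split; last (apply/or_comm; exact: h); rewrite /= ?lexx ?u ?v.
Qed.

(** * The maximum over pairs of permutations *)

Lemma gamma_star_attained :
  exists sa sb, gamma_star X Y = gamma (coded X sa) (coded Y sb).
Proof.
rewrite /gamma_star.
(* The initial value is itself a [gamma], and a maximum of two such values is one of them. *)
elim/big_ind: _ => [|x y [sa [sb ->]] [sa' [sb' ->]]|[sa sb] _].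
- by exists 1%g, 1%g.
- by rewrite maxEle; case: ifP => _; [exists sa', sb'|exists sa, sb].
- by exists sa, sb.
Qed.

Lemma gamma_le_gamma_star sa sb :
  gamma (coded X sa) (coded Y sb) <= gamma_star X Y.
Proof.
exact: (le_bigmax _ (fun s : 'S_#|O1| * 'S_#|O2| =>
  gamma (coded X s.1) (coded Y s.2)) (sa, sb)).
Qed.

Lemma gamma_star_ge0 : 0 <= gamma_star X Y.
Proof.
have := gamma_le_gamma_star 1%g 1%g.
have := gamma_le_gamma_star (1 * rev_perm #|O1|)%g 1%g.
by rewrite gamma_rev; lra.
Qed.

Lemma gamma_star_eq0 : (1 < #|O1|)%N -> (1 < #|O2|)%N ->
  gamma_star X Y = 0 <-> independent X Y.
Proof.
move=> O1_gt1 O2_gt1; split=> [g0|ind].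
  apply: concordant_independent => sa sb.
  (* Both this value and its opposite are at most 0. *)
  have g : gamma (coded X sa) (coded Y sb) = 0.
    have := gamma_le_gamma_star sa sb.
    have := gamma_le_gamma_star (sa * rev_perm #|O1|)%g sb.
    by rewrite gamma_rev g0; lra.
  apply/eqP; rewrite -subr_eq0; move/eqP: g; rewrite mulf_eq0 invr_eq0.
  by rewrite [X in _ || X]gt_eqF ?orbF//; exact: concordantD_gt0.
have [sa [sb ->]] := gamma_star_attained.
by rewrite /gamma independent_concordant// subrr mul0r.
Qed.

Lemma gamma_star_eq1 : (1 < #|O1|)%N -> (1 < #|O2|)%N ->
  gamma_star X Y = 1 <-> perfectly_dependent X Y.
Proof.
move=> O1_gt1 O2_gt1; split=> [g1|[sa [sb bound]]].
  have [sa [sb gE]] := gamma_star_attained.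
  exists sa, sb; left; apply/upper_bound_discordant.
  by apply/gamma_eq1 => //; rewrite -gE.
(* No [gamma] exceeds 1, so one value equal to 1 is already the maximum. *)
suff [s' g1] : exists s', gamma (coded X s') (coded Y sb) = 1.
  apply/le_anti; rewrite -{2}g1 gamma_le_gamma_star andbT.
  by have [? [? ->]] := gamma_star_attained; exact: gamma_le1.
case: bound => [/upper_bound_discordant D0|/lower_bound_concordant C0].
  by exists sa; apply/gamma_eq1.
exists (sa * rev_perm #|O1|)%g; apply/gamma_eq1 => //.
by rewrite discordant_rev.
Qed.

End Gamma.

Section Symmetry.
Context {d : measure_display} {T : measurableType d} {R : realType}.
Context {P : probability T R}.

Lemma gammaC (V W : {RV P >-> R}) : gamma V W = gamma W V.
Proof.
have C : prob_concordant V W = prob_concordant W V.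
  by rewrite /prob_concordant; under eq_set do rewrite mulrC.
have D : prob_discordant V W = prob_discordant W V.
  by rewrite /prob_discordant; under eq_set do rewrite mulrC.
by rewrite /gamma C D.
Qed.

(** A maximizing pair of permutations, exchanged, is a candidate for [gamma_star Y X]; applied both
    ways this gives equality. *)
Lemma gamma_star_leC (O1 O2 : finType)
    (X : nominalRV P O1) (Y : nominalRV P O2) :
  gamma_star X Y <= gamma_star Y X.
Proof.
have [sa [sb ->]] := gamma_star_attained X Y.
by rewrite gammaC gamma_le_gamma_star.
Qed.

End Symmetry.

Theorem proposition5p3 (d : measure_display) (T : measurableType d)
    (R : realType) (P : probability T R) (O1 O2 : finType)
    (hO1 : (3 <= #|O1|)%N) (hO2 : (3 <= #|O2|)%N)
    (X : nominalRV P O1) (Y : nominalRV P O2) :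
  [/\ (* (A) existence *)
      [/\ forall (sa : 'S_#|O1|) (sb : 'S_#|O2|),
            gamma_exists (coded X sa) (coded Y sb),
          exists (sa : 'S_#|O1|) (sb : 'S_#|O2|),
            gamma_star X Y = gamma (coded X sa) (coded Y sb)
        & forall (sa : 'S_#|O1|) (sb : 'S_#|O2|),
            gamma (coded X sa) (coded Y sb) <= gamma_star X Y],
      (* (B) normalization *)
      0 <= gamma_star X Y <= 1,
      (* (C) independence *)
      gamma_star X Y = 0 <-> independent X Y,
      (* (D) attainability *)
      gamma_star X Y = 1 <-> perfectly_dependent X Y
    & (* (F) symmetry *)
      gamma_star X Y = gamma_star Y X].
Proof.
have O1_gt1 : (1 < #|O1|)%N by exact: ltnW.
have O2_gt1 : (1 < #|O2|)%N by exact: ltnW.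
split.
- split=> [sa sb||].
  + by rewrite /gamma_exists gt_eqF// concordantD_gt0.
  + exact: gamma_star_attained.
  + exact: gamma_le_gamma_star.
- rewrite gamma_star_ge0 /=.
  by have [sa [sb ->]] := gamma_star_attained X Y; exact: gamma_le1.
- exact: gamma_star_eq0.
- exact: gamma_star_eq1.
- by apply/le_anti; rewrite !gamma_star_leC.
Qed.
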